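(* For the augmented system $\dot X_i=TX_i+B_1u_i+D_1\omega_i+E_1\upsilon_i$, the optimal solution (control input against the worst-case attack) for the discounted performance function $$J(X_i,u_i,\omega_i)=\int_t^\infty e^{-\alpha_i(\tau-t)}\left[X_i^TQ_iX_i+u_i^TR_iu_i-\gamma_i^2\omega_i^T\omega_i\right]d\tau$$ is $$u_i^*=-R_i^{-1}B_1^T(P_iX_i+\Pi_i),$$ where $P_i$ and $\Pi_i$ are the solution of the following non-homogeneous game algebraic Riccati equation: $$P_iT+T^TP_i-\alpha_iP_i-P_iB_1R_i^{-1}B_1^TP_i+\frac1{\gamma_i^2}P_iD_1D_1^TP_i+Q_i=0,$$ $$\dot\Pi_i=\left(\alpha_iI_{2n}+P_iB_1R_i^{-1}B_1^T-T^T-\frac1{\gamma_i^2}P_iD_1D_1^T\right)\Pi_i-P_iE_1\upsilon_i,$$ $$\dot\Gamma_i=\alpha_i\Gamma_i+\Pi_i^TB_1R_i^{-1}B_1^T\Pi_i-\frac1{\gamma_i^2}\Pi_i^TD_1D_1^T\Pi_i-2\upsilon_i^TE_1^T\Pi_i.$$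
   Context: Agent $i$ has dynamics $\dot x_i=Ax_i+Bu_i+D\omega_i$ with $x_i\in\mathbb{R}^n$, $u_i\in\mathbb{R}^m$ and attack signal $\omega_i\in\mathbb{R}^d$; its observer has dynamics $\dot r_i=Ar_i+B\upsilon_i$, with $\upsilon_i(t)\in\mathbb{R}^m$ the observer input. Put $\epsilon_i=x_i-r_i$ and $X_i=[\epsilon_i^T\ r_i^T]^T\in\mathbb{R}^{2n}$. The augmented matrices are $$T=\begin{bmatrix}A&0\\0&A\end{bmatrix},\quad B_1=\begin{bmatrix}B\\0\end{bmatrix},\quad D_1=\begin{bmatrix}D\\0\end{bmatrix},\quad E_1=\begin{bmatrix}-B\\ B\end{bmatrix},\quad Q_i=\begin{bmatrix}Q_{1i}&0\\0&0\end{bmatrix},$$ with $Q_{1i}$ and $R_i$ symmetric positive definite, discount factor $\alpha_i>0$ and attenuation level $\gamma_i>0$. The pair $(A,B)$ is stabilizable. The control is sought in the non-homogeneous form $u_i=K_iX_i+g_i$, and the value function has the form $V_i(X_i(t))=X_i^TP_iX_i+2X_i^T\Pi_i+\Gamma_i$, with $P_i$ a constant symmetric matrix and $\Pi_i(t)\in\mathbb{R}^{2n}$, $\Gamma_i(t)\in\mathbb{R}$ time-dependent. The Hamiltonian is $$H(X_i,u_i,\omega_i)=X_i^TQ_iX_i+u_i^TR_iu_i-\gamma_i^2\omega_i^T\omega_i-\alpha_iV_i+\frac{dV_i}{dt},$$ with $dV_i/dt$ taken along the augmented system. Optimality is understood in the zero-sum (H-infinity) game sense, in which $u_i$ minimizes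 and the attack $\omega_i$ maximizes $J$; the optimal pair is characterized by stationarity of the Hamiltonian in $u_i$ and $\omega_i$ together with vanishing of the Hamiltonian at the optimal pair for all $X_i$. *)

(* Defs.v *)
From HB Require Import structures.
From mathcomp Require Import all_boot all_order all_algebra complex.
From mathcomp Require Import all_classical all_reals all_analysis.

Set Implicit Arguments.
Unset Strict Implicit.
Unset Printing Implicit Defensive.

Import Order.TTheory GRing.Theory Num.Theory.
Import numFieldNormedType.Exports.

Local Open Scope classical_set_scope.
Local Open Scope ring_scope.

Definition dotv (R : realType) (n : nat) (x y : 'cV[R]_n) : R :=
  (x^T *m y) 0 0.

Definition quad (R : realType) (n : nat) (M : 'M[R]_n) (x : 'cV[R]_n) : R :=
  (x^T *m M *m x) 0 0.

Definition sym_posdef (R : realType) (n : nat) (M : 'M[R]_n) : Prop :=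
  M^T = M /\ forall x : 'cV[R]_n, x != 0 -> 0 < quad M x.

Definition hurwitz (R : realType) (n : nat) (M : 'M[R]_n) : Prop :=
  forall z : R[i], eigenvalue (map_mx (real_complex R) M) z -> complex.Re z < 0.

Definition stabilizable (R : realType) (n m : nat)
    (A : 'M[R]_n) (B : 'M[R]_(n, m)) : Prop :=
  exists K : 'M[R]_(m, n), hurwitz (A + B *m K).

(* The data of a single agent: its dynamics, the weights of its performance
   function and the (exogenous) input ups of its observer. *)
Record agent (R : realType) (n m d : nat) := Agent {
  sysA : 'M[R]_n;
  sysB : 'M[R]_(n, m);
  sysD : 'M[R]_(n, d);
  wQ1 : 'M[R]_n;
  wR : 'M[R]_m;
  alpha : R;
  gamma : R;
  ups : R -> 'cV[R]_m }.

Section Game.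
Context (R : realType) (n m d : nat) (G : agent R n m d).

Definition augT : 'M[R]_(n + n) := block_mx (sysA G) 0 0 (sysA G).
Definition augB1 : 'M[R]_(n + n, m) := col_mx (sysB G) 0.
Definition augD1 : 'M[R]_(n + n, d) := col_mx (sysD G) 0.
Definition augE1 : 'M[R]_(n + n, m) := col_mx (- sysB G) (sysB G).
Definition augQ : 'M[R]_(n + n) := block_mx (wQ1 G) 0 0 0.

Definition aug_field (t : R) (X : 'cV[R]_(n + n)) (u : 'cV[R]_m)
    (w : 'cV[R]_d) : 'cV[R]_(n + n) :=
  augT *m X + augB1 *m u + augD1 *m w + augE1 *m ups G t.

Definition stage_cost (X : 'cV[R]_(n + n)) (u : 'cV[R]_m) (w : 'cV[R]_d) : R :=
  quad augQ X + quad (wR G) u - gamma G ^+ 2 * dotv w w.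

Definition discounted_cost (t : R) (X : R -> 'cV[R]_(n + n))
    (u : R -> 'cV[R]_m) (w : R -> 'cV[R]_d) (tau : R) : R :=
  expR (- alpha G * (tau - t)) * stage_cost (X tau) (u tau) (w tau).

Definition performance (t : R) (X : R -> 'cV[R]_(n + n))
    (u : R -> 'cV[R]_m) (w : R -> 'cV[R]_d) : R :=
  \int[lebesgue_measure]_(tau in `[t, +oo[) discounted_cost t X u w tau.

(* dV/dt along the augmented system, when the state is X at time t and the
   inputs are u and w: partial time derivative plus the derivative of V t in the
   direction of the vector field. *)
Definition dVdt (V : R -> 'cV[R]_(n + n) -> R) (t : R) (X : 'cV[R]_(n + n))
    (u : 'cV[R]_m) (w : 'cV[R]_d) : R :=
  'D_1 (fun s : R => V s X) t + 'D_(aug_field t X u w) (V t) X.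

Definition hamiltonian (V : R -> 'cV[R]_(n + n) -> R) (t : R)
    (X : 'cV[R]_(n + n)) (u : 'cV[R]_m) (w : 'cV[R]_d) : R :=
  stage_cost X u w - alpha G * V t X + dVdt V t X u w.

(* A pair of policies is optimal for the value function V when the Hamiltonian
   is stationary in u and in w at the pair, and vanishes there, for every state
   (and at every time, V and the policies being time-dependent).  Policies are
   arbitrary functions of time and state; in particular they are not assumed to
   be affine in the state. *)
Definition optimal_pair (V : R -> 'cV[R]_(n + n) -> R)
    (us : R -> 'cV[R]_(n + n) -> 'cV[R]_m)
    (ws : R -> 'cV[R]_(n + n) -> 'cV[R]_d) : Prop :=
  forall (t : R) (X : 'cV[R]_(n + n)),
  [/\ forall v : 'cV[R]_m,
        is_derive (us t X) v (fun u => hamiltonian V t X u (ws t X)) 0,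
      forall v : 'cV[R]_d,
        is_derive (ws t X) v (fun w => hamiltonian V t X (us t X) w) 0 &
      hamiltonian V t X (us t X) (ws t X) = 0].

(* A play from time t: continuous inputs and a corresponding trajectory of the
   augmented system on [t, +oo[, with finite performance, and along which the
   discounted value V tends to 0. *)
Definition play (V : R -> 'cV[R]_(n + n) -> R) (t : R)
    (X : R -> 'cV[R]_(n + n)) (u : R -> 'cV[R]_m) (w : R -> 'cV[R]_d) : Prop :=
  [/\ {within `[t, +oo[, continuous u},
      {within `[t, +oo[, continuous w} &
      {within `[t, +oo[, continuous (ups G)}] /\
  [/\ {within `[t, +oo[, continuous X},
      forall tau : R, t < tau ->
        is_derive tau 1 X (aug_field tau (X tau) (u tau) (w tau)),
      lebesgue_measure.-integrable `[t, +oo[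
        (fun tau => (discounted_cost t X u w tau)%:E) &
      expR (- alpha G * (tau - t)) * V tau (X tau) @[tau --> +oo] --> (0 : R)].

Definition follows (k : nat) (t : R) (X : R -> 'cV[R]_(n + n))
    (u : R -> 'cV[R]_k) (us : R -> 'cV[R]_(n + n) -> 'cV[R]_k) : Prop :=
  forall tau : R, t <= tau -> u tau = us tau (X tau).

(* (us, ws) is a saddle point of the performance function, with game value V:
   the pair achieves V, no control does better (less) against the attack policy
   ws, and no attack does better (more) against the control policy us. *)
Definition saddle_point (V : R -> 'cV[R]_(n + n) -> R)
    (us : R -> 'cV[R]_(n + n) -> 'cV[R]_m)
    (ws : R -> 'cV[R]_(n + n) -> 'cV[R]_d) : Prop :=
  forall (t : R) (X : R -> 'cV[R]_(n + n)) (u : R -> 'cV[R]_m)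
    (w : R -> 'cV[R]_d), play V t X u w ->
  [/\ follows t X u us -> follows t X w ws -> performance t X u w = V t (X t),
      follows t X w ws -> V t (X t) <= performance t X u w &
      follows t X u us -> performance t X u w <= V t (X t)].

End Game.

Definition affine_quad_value (R : realType) (N : nat) (P : 'M[R]_N)
    (Pi : R -> 'cV[R]_N) (Gam : R -> R) (t : R) (X : 'cV[R]_N) : R :=
  quad P X + 2 * dotv X (Pi t) + Gam t.

(* Main.v *)
(* Write p = P X + Pi for half the gradient of V.  The Hamiltonian is quadratic
   in u and in w separately, with gradients 2 (R u + B1^T p) and
   2 (D1^T p - gamma^2 w), so stationarity determines the policies.
   Substituting them leaves a quadratic polynomial in X whose coefficients are
   the Riccati residual and the residuals of the equations for Pi and Gam; it
   vanishes for all X iff these do.  At an optimal pair the expansion around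
   (us, ws) is exact,
     H(X, u, w) = (u - us)^T R (u - us) - gamma^2 |w - ws|^2,
   and along a play e^(-alpha (s - t)) V(s, X s) has derivative
   e^(-alpha (s - t)) H minus the discounted cost, so the sign of H decides the
   comparison of the performance with V(t, X t). *)

Require Import Defs.
From HB Require Import structures.
From mathcomp Require Import all_boot all_order all_algebra complex.
From mathcomp Require Import all_classical all_reals all_analysis.
From mathcomp Require Import ring lra.

Set Implicit Arguments.
Unset Strict Implicit.
Unset Printing Implicit Defensive.

Import Order.TTheory GRing.Theory Num.Theory.
Import numFieldNormedType.Exports.

Local Open Scope classical_set_scope.
Local Open Scope ring_scope.

(** * Integrals over a half-line and dissipation inequalities *)

(** Dominated convergence: the truncations of [c] to [[t, t + k]] are bounded by [|c|] and converge
    pointwise to [c]. *)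
Lemma Rintegral_itvcy_cvg (R : realType) (c : R -> R) (t : R) :
  lebesgue_measure.-integrable `[t, +oo[ (EFin \o c) ->
  \int[lebesgue_measure]_(x in `[t, t + k%:R]) c x @[k --> \oo] -->
  \int[lebesgue_measure]_(x in `[t, +oo[) c x.
Proof.
move=> ic.
pose f_ (k : nat) : R -> \bar R := (EFin \o c) \_ `[t, t + k%:R].
have sub k : `[t, t + k%:R] `<=` `[t, +oo[ by exact: subset_itvl.
have f_E k : (\int[lebesgue_measure]_(x in `[t, (t + k%:R)%R]) (c x)%:E
    = \int[lebesgue_measure]_(x in `[t, +oo[) f_ k x)%E.
  by rewrite -integral_mkcondr setIidr.
apply: fine_cvg; rewrite fineK; last exact: integrable_fin_num.
under eq_fun do rewrite f_E.
have /integrableP[mc _] := ic.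
have [] // := @dominated_convergence _ _ _ (@lebesgue_measure R) _
  (measurable_itv `[t, +oo[) f_ (EFin \o c) (abse \o (EFin \o c)).
- move=> k.
  suff /integrableP[] : lebesgue_measure.-integrable `[t, +oo[ (f_ k) by [].
  apply/integrable_restrict => //; rewrite setIidr//.
  exact: integrableS ic.
(* At a fixed [x] the truncations equal [c x] as soon as [k >= x - t]. *)
- apply/aeW => x /=; rewrite in_itv/= andbT => tx.
  apply: cvg_near_cst; near=> k.
  rewrite /f_ patchE ifT// inE/= in_itv/= tx/= -lerBlDl.
  by near: k; exact: nbhs_infty_ger.
- exact: integrable_abse.
- apply/aeW => x k _; rewrite /f_ patchE; case: ifPn => // _.
  (* Off the interval the restriction takes the default [point], which is 0 in the extended
     reals. *)
  by rewrite (_ : (fun _ => point) x = 0%E) ?abse0 ?abse_ge0.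
Unshelve. all: by end_near. Qed.

(* F plus the accumulated cost is nondecreasing; no continuity of the derivative
   of F is needed. *)
Lemma dissipation_le (R : realType) (F c : R -> R) (t : R) :
  {within `[t, +oo[, continuous F} ->
  {within `[t, +oo[, continuous c} ->
  lebesgue_measure.-integrable `[t, +oo[ (EFin \o c) ->
  (forall s : R, t < s -> exists2 dF, is_derive s 1 F dF & 0 <= dF + c s) ->
  F s @[s --> +oo] --> (0 : R) ->
  F t <= \int[lebesgue_measure]_(s in `[t, +oo[) c s.
Proof.
move=> cF cc ic dF F0.
pose C s := \int[lebesgue_measure]_(x in `[t, s]) c x.
have icb s : lebesgue_measure.-integrable `[t, s] (EFin \o c).
  by apply: integrableS ic => //; exact: subset_itvl.
have dC s : t < s -> is_derive s 1 C (c s).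
  (* The fundamental theorem is applied on [[t, s + 1]], which has [s] in its interior. *)
  move=> ts; have s1 : s < s + 1 by rewrite ltrDl.
  have [] := continuous_FTC1_closed s1 (icb _) ts.
    move/continuous_within_itvcyP: cc => [cc _].
    by apply: cc; rewrite in_itv/= andbT.
  by move=> ? ?; split => //; rewrite -derive1E.
have cC : {within `[t, +oo[, continuous C}.
  apply/continuous_within_itvcyP; split.
    move=> s; rewrite in_itv/= andbT => /dC[dCs _].
    exact/differentiable_continuous/derivable1_diffP.
  (* At the left endpoint, [C t] is an integral over a single point, hence 0. *)
  apply/cvg_at_right_filter.
  rewrite {2}/C set_itv1 Rintegral_set1.
  by apply: (@parameterized_integral_cvg_left _ _ (t + 1)) => //; rewrite ltrDl.
have dFC s : s \in `]t, +oo[ ->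
    exists2 d, is_derive s 1 (F + C) d & 0 <= d.
  rewrite in_itv/= andbT => ts; have [d dFs d0] := dF _ ts.
  by exists (d + c s) => //; apply: is_deriveD => //; exact: dC.
have mono s : t <= s -> F t <= F s + C s.
  move=> ts; have -> : F t = (F + C) t.
    by rewrite fctE /C set_itv1 Rintegral_set1 addr0.
  rewrite -[leRHS]/((F + C) s); apply: (ger0_derive1_ndecry _ _ _ _ ts) => //.
  - by move=> x /dFC[d []].
  - by move=> x /dFC[d [dx dE]]; rewrite derive1E dE.
  - by move=> x; apply: continuousD; [exact: cF|exact: cC].
(* The monotonicity bound is passed to the limit along the times [t + k]: [F] vanishes there and [C]
   tends to the full integral. *)
have lim : F (t + k%:R) + C (t + k%:R) @[k --> \oo] -->
    0 + \int[lebesgue_measure]_(s in `[t, +oo[) c s.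
  apply: cvgD; last exact: Rintegral_itvcy_cvg.
  have : t + k%:R @[k --> \oo] --> +oo.
    exact: (cvg_comp _ _ (@cvgr_idn R) (cvg_addrl t)).
  by move/cvg_comp; apply.
rewrite -[leRHS]add0r -(cvg_lim _ lim)//; apply: limr_ge.
  by apply/cvg_ex; eexists; exact: lim.
by apply: nearW => k; apply: mono; rewrite lerDl.
Qed.

(** The previous inequality for [- F] and [- c]. *)
Lemma dissipation_ge (R : realType) (F c : R -> R) (t : R) :
  {within `[t, +oo[, continuous F} ->
  {within `[t, +oo[, continuous c} ->
  lebesgue_measure.-integrable `[t, +oo[ (EFin \o c) ->
  (forall s : R, t < s -> exists2 dF, is_derive s 1 F dF & dF + c s <= 0) ->
  F s @[s --> +oo] --> (0 : R) ->
  \int[lebesgue_measure]_(s in `[t, +oo[) c s <= F t.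
Proof.
move=> cF cc ic dF F0; rewrite -[leRHS]opprK -[leLHS]opprK lerN2.
have -> : - (\int[lebesgue_measure]_(s in `[t, +oo[) c s) =
    \int[lebesgue_measure]_(s in `[t, +oo[) (-1 * c s).
  by rewrite RintegralZl// mulN1r.
apply: (@dissipation_le _ (- F) (fun s => -1 * c s)).
- by move=> x; apply: continuousN; exact: cF.
- by move=> x; apply: cvgMl_tmp; exact: cc.
- rewrite (_ : _ \o _ = -%E \o (EFin \o c)); first exact: integrableN.
  by apply/funext => x /=; rewrite mulN1r.
- move=> s /dF[d dFs d0]; exists (- d); first exact: is_deriveN.
  by rewrite mulN1r -opprD oppr_ge0.
- by rewrite -oppr0; exact: cvgN.
Qed.

(** On the line through [a] in direction [v] the difference quotient is exactly [c + h * k]. This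
    yields every derivative of the Hamiltonian and of the value in a state or input variable. *)
Lemma is_derive_quadratic (R : realType) (V : normedModType R) (f : V -> R)
    (a v : V) (c k : R) :
  (forall h : R, f (h *: v + a) = f a + h * c + h ^+ 2 * k) ->
  is_derive a v f c.
Proof.
move=> fE.
have key : h^-1 *: (f (h *: v + a) - f a) @[h --> 0^'] --> c.
  apply: (@cvg_trans _ ((c + h * k) @[h --> 0^'])).
    apply: near_eq_cvg; near=> h; rewrite fE.
    have h0 : h != 0 by near: h; exact: nbhs_dnbhs_neq.
    by rewrite /GRing.scale /=; field.
  have -> : c = c + 0 * k by rewrite mul0r addr0.
  apply: cvg_within_filter.
  apply: cvgD; last by apply: cvgMr_tmp; exact: cvg_id.
  by rewrite mul0r addr0; exact: cvg_cst.
split; first by apply/cvg_ex; exists c.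
exact: cvg_lim key.
Unshelve. all: by end_near. Qed.

(** * Algebra of inner products and quadratic forms *)

Section Dotv.
Context (R : realType).
Implicit Types (a b : nat).

Lemma dotvE a (x y : 'cV[R]_a) : dotv x y = \sum_i x i 0 * y i 0.
Proof. by rewrite /dotv !mxE; apply: eq_bigr => i _; rewrite mxE. Qed.

Lemma dotvC a (x y : 'cV[R]_a) : dotv x y = dotv y x.
Proof. by rewrite !dotvE; apply: eq_bigr => i _; rewrite mulrC. Qed.

Lemma dotvDr a (x y z : 'cV[R]_a) : dotv x (y + z) = dotv x y + dotv x z.
Proof. by rewrite /dotv mulmxDr mxE. Qed.

Lemma dotvDl a (x y z : 'cV[R]_a) : dotv (x + y) z = dotv x z + dotv y z.
Proof. by rewrite dotvC dotvDr !(dotvC z). Qed.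

Lemma dotvZr a (k : R) (x y : 'cV[R]_a) : dotv x (k *: y) = k * dotv x y.
Proof. by rewrite /dotv -scalemxAr mxE. Qed.

Lemma dotvZl a (k : R) (x y : 'cV[R]_a) : dotv (k *: x) y = k * dotv x y.
Proof. by rewrite dotvC dotvZr dotvC. Qed.

Lemma dot0v a (x : 'cV[R]_a) : dotv 0 x = 0.
Proof. by rewrite /dotv trmx0 mul0mx mxE. Qed.

Lemma dotv0 a (x : 'cV[R]_a) : dotv x 0 = 0.
Proof. by rewrite dotvC dot0v. Qed.

Lemma dotvNr a (x y : 'cV[R]_a) : dotv x (- y) = - dotv x y.
Proof. by rewrite -scaleN1r dotvZr mulN1r. Qed.

Lemma dotvNl a (x y : 'cV[R]_a) : dotv (- x) y = - dotv x y.
Proof. by rewrite -scaleN1r dotvZl mulN1r. Qed.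

Lemma dotv_mulmxr a b (M : 'M[R]_(a, b)) (x : 'cV[R]_a) (y : 'cV[R]_b) :
  dotv x (M *m y) = dotv (M^T *m x) y.
Proof. by rewrite /dotv trmx_mul trmxK mulmxA. Qed.

Lemma quadE a (M : 'M[R]_a) (x : 'cV[R]_a) : quad M x = dotv x (M *m x).
Proof. by rewrite /quad /dotv mulmxA. Qed.

Lemma quadD a (M : 'M[R]_a) (x y : 'cV[R]_a) : M^T = M ->
  quad M (x + y) = quad M x + 2 * dotv (M *m x) y + quad M y.
Proof.
move=> MT; rewrite !quadE mulmxDr !dotvDl !dotvDr (dotv_mulmxr M x y) MT.
by rewrite (dotvC y (M *m x)); ring.
Qed.

Lemma quadZ a (M : 'M[R]_a) (k : R) (x : 'cV[R]_a) :
  quad M (k *: x) = k ^+ 2 * quad M x.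
Proof. by rewrite !quadE -scalemxAr dotvZl dotvZr; ring. Qed.

Lemma dotv_ge0 a (x : 'cV[R]_a) : 0 <= dotv x x.
Proof. by rewrite dotvE sumr_ge0// => i _; rewrite -expr2 sqr_ge0. Qed.

Lemma dotv_eq0P a (x : 'cV[R]_a) : (forall y, dotv x y = 0) -> x = 0.
Proof.
move=> x0; apply/colP => i; rewrite mxE.
by have := x0 (delta_mx i 0); rewrite /dotv -colE !mxE.
Qed.

Lemma sym_posdef_quad_ge0 a (M : 'M[R]_a) (x : 'cV[R]_a) :
  sym_posdef M -> 0 <= quad M x.
Proof.
case=> _ Mpos; have [->|/Mpos/ltW//] := eqVneq x 0.
by rewrite quadE dot0v.
Qed.

(** A nonzero row vector [v] with [v *m M = 0] would give [quad M v^T = 0]. *)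
Lemma sym_posdef_unitmx a (M : 'M[R]_a) : sym_posdef M -> M \in unitmx.
Proof.
case=> MT Mpos; rewrite unitmxE unitfE; apply/det0P => -[v v0 vM].
have := Mpos v^T; rewrite /quad trmxK vM mul0mx mxE ltxx.
suff -> : v^T != 0 by move/(_ isT).
by apply: contra v0 => /eqP vT; rewrite -[v]trmxK vT trmx0.
Qed.

(* Evaluating at X and - X separates the parities; polarization then
   kills the quadratic part. *)
Lemma affine_quad_eq0 a (M : 'M[R]_a) (b : 'cV[R]_a) (c : R) : M^T = M ->
  (forall X, quad M X + 2 * dotv X b + c = 0) -> [/\ M = 0, b = 0 & c = 0].
Proof.
move=> MT H0.
have c0 : c = 0 by have := H0 0; rewrite quadE !dot0v; lra.
have qN X : quad M (- X) = quad M X by rewrite -scaleN1r quadZ; ring.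
have b0 X : dotv X b = 0.
  by have := H0 X; have := H0 (- X); rewrite qN dotvNl; lra.
have q0 X : quad M X = 0 by have := H0 X; rewrite b0; lra.
have M0 X Y : dotv (M *m X) Y = 0.
  by have := quadD X Y MT; rewrite !q0; lra.
split=> //; last by apply: dotv_eq0P => y; rewrite dotvC.
apply/matrixP => i j; have := M0 (delta_mx j 0) (delta_mx i 0).
by rewrite dotvC /dotv trmx_delta -rowE -colE !mxE.
Qed.

(** * Derivatives and limits of vector expressions, entry by entry *)

Lemma is_derive_mxP (W : normedModType R) a b (M : W -> 'M[R]_(a, b)) t v dM :
  is_derive t v M dM <->
  forall i j, is_derive t v (fun s => M s i j) (dM i j).
Proof.
split=> [[DM ME] i j|H].
  split; first exact: (proj1 (derivable_mxP M t v) DM).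
  by rewrite -ME derive_mx// mxE.
have DM : derivable M t v.
  by apply: (proj2 (derivable_mxP M t v)) => i j; have [] := H i j.
split=> //; rewrite derive_mx//; apply/matrixP => i j.
by rewrite mxE; have [] := H i j.
Qed.

Lemma is_derive_dotv (W : normedModType R) a (X Y : W -> 'cV[R]_a) t v dX dY :
  is_derive t v X dX -> is_derive t v Y dY ->
  is_derive t v (fun s => dotv (X s) (Y s)) (dotv (X t) dY + dotv dX (Y t)).
Proof.
move=> /is_derive_mxP HX /is_derive_mxP HY.
have -> : (fun s => dotv (X s) (Y s)) =
    \sum_(i < a) ((fun s => X s i 0) * (fun s => Y s i 0)).
  by apply/funext => s; rewrite dotvE fct_sumE.
rewrite !dotvE -big_split/=; apply: is_derive_eq.
by apply: eq_bigr => i _; rewrite /GRing.scale/= mulrC [X in _ + X]mulrC addrC.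
Qed.

Lemma is_derive_mulmxl (W : normedModType R) a b c (M : 'M[R]_(a, b))
    (X : W -> 'M[R]_(b, c)) t v dX :
  is_derive t v X dX -> is_derive t v (fun s => M *m X s) (M *m dX).
Proof.
move=> /is_derive_mxP HX; apply/is_derive_mxP => i j.
have -> : (fun s => (M *m X s) i j) = \sum_k (M i k \*: (fun s => X s k j)).
  by apply/funext => s; rewrite mxE fct_sumE.
by rewrite mxE; apply: is_derive_eq.
Qed.

(** This and the next limits are stated for an arbitrary filter, so that they also serve for
    continuity within a half-line. *)
Lemma cvg_coord (S : Type) (F : set_system S) (FF : Filter F) a b
    (M : S -> 'M[R]_(a, b)) (N : 'M[R]_(a, b)) i j :
  M s @[s --> F] --> N -> M s i j @[s --> F] --> N i j.
Proof.
by move=> MN; exact: (cvg_comp _ _ MN (@coord_continuous R _ _ i j N)).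
Qed.

Lemma cvg_sumr (S : Type) (F : set_system S) (FF : Filter F) a
    (f : 'I_a -> S -> R) (l : 'I_a -> R) :
  (forall i, f i s @[s --> F] --> l i) ->
  \sum_i f i s @[s --> F] --> \sum_i l i.
Proof.
move=> fl; apply: cvg_big => //; exact: add_continuous.
Qed.

Lemma cvg_dotv (S : Type) (F : set_system S) (FF : Filter F) a
    (X Y : S -> 'cV[R]_a) (x y : 'cV[R]_a) :
  X s @[s --> F] --> x -> Y s @[s --> F] --> y ->
  dotv (X s) (Y s) @[s --> F] --> dotv x y.
Proof.
move=> Xx Yy; rewrite dotvE; under eq_fun do rewrite dotvE.
by apply: cvg_sumr => i; apply: cvgM; exact: cvg_coord.
Qed.

Lemma cvg_quad (S : Type) (F : set_system S) (FF : Filter F) a (M : 'M[R]_a)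
    (X : S -> 'cV[R]_a) (x : 'cV[R]_a) :
  X s @[s --> F] --> x -> quad M (X s) @[s --> F] --> quad M x.
Proof.
move=> Xx.
have qE y : quad M y = \sum_i \sum_j M i j * (y i 0 * y j 0).
  rewrite quadE dotvE; apply: eq_bigr => i _; rewrite mxE mulr_sumr.
  by apply: eq_bigr => j _; ring.
rewrite qE; under eq_fun do rewrite qE.
apply: cvg_sumr => i; apply: cvg_sumr => j; apply: cvgMl_tmp.
by apply: cvgM; exact: cvg_coord.
Qed.

End Dotv.

(** * The Hamiltonian of an affine-quadratic value function *)

Section AffineQuadValue.
Context (R : realType) (n m d : nat) (G : agent R n m d).
Context (P : 'M[R]_(n + n)) (Pi : R -> 'cV[R]_(n + n)) (Gam : R -> R).
Context (hP : P^T = P) (hPi : forall t, derivable Pi t 1)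
  (hGam : forall t, derivable Gam t 1).

Let V := affine_quad_value P Pi Gam.
Let T := augT G.
Let B1 := augB1 G.
Let D1 := augD1 G.
Let E1 := augE1 G.
Let Q := augQ G.
Let Ri := invmx (wR G).
Let g2 := (gamma G ^+ 2)^-1.
Let costate t X := P *m X + Pi t.

Lemma is_derive_value_state t X v :
  is_derive X v (V t) (2 * dotv (costate t X) v).
Proof.
apply: (@is_derive_quadratic _ _ _ _ _ _ (quad P v)) => h.
rewrite /V /affine_quad_value (addrC (h *: v)) quadD// quadZ dotvZr !dotvDl.
rewrite dotvZl.
by rewrite (dotvC (Pi t) v); ring.
Qed.

Lemma is_derive_value_time (t : R) X :
  is_derive t 1 (V^~ X) (2 * dotv X ('D_1 Pi t) + 'D_1 Gam t).
Proof.
have DPi := is_derive_dotv (is_derive_cst X t (1 : R)) (derivableP (@hPi t)).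
have DGam := derivableP (@hGam t).
have -> : V^~ X =
    cst (quad P X) + (2 \*: (fun s => dotv X (Pi s)) : R -> R) + Gam by [].
by apply: is_derive_eq; rewrite dot0v addr0 add0r.
Qed.

Lemma hamiltonianE t X u w :
  hamiltonian G V t X u w = stage_cost G X u w - alpha G * V t X
    + (2 * dotv X ('D_1 Pi t) + 'D_1 Gam t
       + 2 * dotv (costate t X) (aug_field G t X u w)).
Proof.
rewrite /hamiltonian /dVdt; congr (_ + (_ + _)).
  by have [_ ->] := is_derive_value_time t X.
by have [_ ->] := is_derive_value_state t X (aug_field G t X u w).
Qed.

(** An exact second-order expansion in both inputs at once. There is no cross term in [h] and [k],
    because the cost separates and the field is affine in the inputs. Setting one increment to 0
    gives the two gradients; keeping both gives the saddle identity. *)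
Lemma hamiltonian_shift t X u w h k : (wR G)^T = wR G ->
  hamiltonian G V t X (h + u) (k + w) = hamiltonian G V t X u w
    + 2 * dotv (wR G *m u + B1^T *m costate t X) h + quad (wR G) h
    + (2 * dotv (D1^T *m costate t X - gamma G ^+ 2 *: w) k
       - gamma G ^+ 2 * dotv k k).
Proof.
move=> RT; rewrite !hamiltonianE /stage_cost /aug_field.
rewrite (addrC h u) quadD// !mulmxDr !dotvDl !dotvDr !dotvNl !dotvZl.
rewrite !(dotv_mulmxr (augB1 G)) !(dotv_mulmxr (augD1 G)) -/B1 -/D1.
by rewrite (dotvC k w); ring.
Qed.

Lemma is_derive_hamiltonian_u t X u w v : (wR G)^T = wR G ->
  is_derive u v (fun u => hamiltonian G V t X u w)
    (2 * dotv (wR G *m u + B1^T *m costate t X) v).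
Proof.
move=> RT; apply: (@is_derive_quadratic _ _ _ _ _ _ (quad (wR G) v)) => h.
have := hamiltonian_shift t X u w (h *: v) 0 RT.
by rewrite add0r => ->; rewrite quadZ dotvZr !dotv0; ring.
Qed.

Lemma is_derive_hamiltonian_w t X u w v : (wR G)^T = wR G ->
  is_derive w v (fun w => hamiltonian G V t X u w)
    (2 * dotv (D1^T *m costate t X - gamma G ^+ 2 *: w) v).
Proof.
move=> RT.
apply: (@is_derive_quadratic _ _ _ _ _ _ (- gamma G ^+ 2 * dotv v v)) => h.
have := hamiltonian_shift t X u w 0 (h *: v) RT.
by rewrite add0r => ->; rewrite quadE dot0v dotv0 !dotvZr dotvZl; ring.
Qed.

(** The Riccati residual, followed by the right-hand sides of the equations for [Pi] and [Gam]. *)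
Let riccati := P *m T + T^T *m P - alpha G *: P
  - P *m B1 *m Ri *m B1^T *m P + g2 *: (P *m D1 *m D1^T *m P) + Q.
Let dPi t := ((alpha G)%:M + P *m B1 *m Ri *m B1^T - T^T
  - g2 *: (P *m D1 *m D1^T)) *m Pi t - P *m E1 *m ups G t.
Let dGam t := alpha G * Gam t
  + ((Pi t)^T *m B1 *m Ri *m B1^T *m Pi t) 0 0
  - g2 * ((Pi t)^T *m D1 *m D1^T *m Pi t) 0 0
  - 2 * ((ups G t)^T *m E1^T *m Pi t) 0 0.

(** Sorting by degree in [X] after substituting the stationary policies: the terms of degree 2, 1
    and 0 are the three residuals. *)
Lemma hamiltonian_optimal t X : sym_posdef (wR G) -> gamma G != 0 ->
  hamiltonian G V t X (- (Ri *m B1^T *m costate t X))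
    (g2 *: (D1^T *m costate t X)) =
  quad riccati X + 2 * dotv X ('D_1 Pi t - dPi t) + ('D_1 Gam t - dGam t).
Proof.
move=> Rpos g0; have RT := Rpos.1.
have Runit := sym_posdef_unitmx Rpos.
have RiT : Ri^T = Ri by rewrite /Ri trmx_inv RT.
have -> : dGam t = alpha G * Gam t
    + dotv (B1^T *m Pi t) (Ri *m (B1^T *m Pi t))
    - g2 * dotv (D1^T *m Pi t) (D1^T *m Pi t)
    - 2 * dotv (ups G t) (E1^T *m Pi t).
  by rewrite /dGam /dotv !trmx_mul !trmxK !mulmxA.
rewrite hamiltonianE /stage_cost /aug_field /V /affine_quad_value.
rewrite -/T -/B1 -/D1 -/E1 -/Q /riccati /dPi.
rewrite !quadE !(mulmxDl, mulNmx, mulmxDr, mulmxN, mul_scalar_mx, dotvDr,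
  dotvNr, dotvDl, dotvNl, dotvZr, dotvZl, =^~ scalemxAl, =^~ scalemxAr).
(* In the control cost, [wR G] cancels against one of the two factors [Ri]. *)
rewrite -!mulmxA !mulKVmx//.
have RiE y z : dotv (Ri *m y) z = dotv y (Ri *m z).
  by rewrite dotv_mulmxr RiT.
have PE y z : dotv y (P *m z) = dotv (P *m y) z by rewrite dotv_mulmxr hP.
(* Each scalar is brought to one normal form by moving matrices across the inner product; the
   [dotvC] rewrites then identify mirrored products, so that only field arithmetic remains. *)
rewrite !RiE !PE !(dotv_mulmxr T^T) !(dotv_mulmxr B1) !(dotv_mulmxr D1).
rewrite !(dotv_mulmxr E1^T) !trmxK -!RiE.
rewrite (dotvC (T *m X) (P *m X)) (dotvC (T *m X) (Pi t)).
rewrite (dotvC (D1^T *m Pi t) (D1^T *m (P *m X))).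
rewrite (dotvC (Ri *m (B1^T *m (P *m X))) (B1^T *m Pi t)) -RiE.
rewrite (dotvC (Pi t) (E1 *m ups G t)) (dotvC (P *m X) (E1 *m ups G t)).
rewrite /g2; set k := gamma G in g0 *.
by field.
Qed.

(** Transposition exchanges [P *m T] with [T^T *m P] and fixes every other term. Symmetry is what
    allows coefficients to be read off from a quadratic form. *)
Lemma trmx_riccati : (wQ1 G)^T = wQ1 G -> (wR G)^T = wR G ->
  riccati^T = riccati.
Proof.
move=> Q1T RT; have RiT : Ri^T = Ri by rewrite /Ri trmx_inv RT.
have QT : Q^T = Q by rewrite /Q /augQ tr_block_mx Q1T !trmx0.
have trD (A B : 'M[R]_(n + n)) : (A + B)^T = A^T + B^T by exact: linearD.
have trN (A : 'M[R]_(n + n)) : (- A)^T = - A^T by exact: linearN.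
have trZ k (A : 'M[R]_(n + n)) : (k *: A)^T = k *: A^T by exact: linearZ.
rewrite /riccati !(trD, trN, trZ) !trmx_mul !trmxK hP RiT QT.
by rewrite !mulmxA (addrC (T^T *m P)).
Qed.

(** * The value along trajectories and its comparison with the performance *)

(** The product rule yields [dVdt], the symmetry of [P] merging the two halves of the quadratic
    term; the definition of the Hamiltonian is then solved for it. *)
Lemma is_derive_value_along (t : R) (X : R -> 'cV[R]_(n + n)) u w :
  is_derive t 1 X (aug_field G t (X t) u w) ->
  is_derive t 1 (fun s => V s (X s))
    (hamiltonian G V t (X t) u w - stage_cost G (X t) u w
     + alpha G * V t (X t)).
Proof.
move=> DX; have DPX := is_derive_mulmxl P DX.
have Dq := is_derive_dotv DX DPX.
have Dl := is_derive_dotv DX (derivableP (@hPi t)).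
have Dg := derivableP (@hGam t).
have -> : (fun s => V s (X s)) = (fun s => dotv (X s) (P *m X s)) +
    (2 \*: (fun s => dotv (X s) (Pi s)) : R -> R) + Gam.
  by apply/funext => s; rewrite /V /affine_quad_value quadE.
apply: is_derive_eq; rewrite hamiltonianE.
move: (aug_field _ _ _ _ _) => f; rewrite /costate dotvDl.
rewrite (dotv_mulmxr P) hP (dotvC (Pi t)) (dotvC f (P *m X t)).
by rewrite /GRing.scale/=; ring.
Qed.

Lemma cvg_value (F : set_system R) (FF : Filter F)
    (X : R -> 'cV[R]_(n + n)) s x :
  F `=>` nbhs s -> X r @[r --> F] --> x -> V r (X r) @[r --> F] --> V s x.
Proof.
move=> Fs Xx.
have Pic : Pi r @[r --> F] --> Pi s.
  apply: (cvg_trans (cvg_app Pi Fs)).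
  exact/differentiable_continuous/derivable1_diffP/hPi.
have Gamc : Gam r @[r --> F] --> Gam s.
  apply: (cvg_trans (cvg_app Gam Fs)).
  exact/differentiable_continuous/derivable1_diffP/hGam.
apply: cvgD => //; apply: cvgD; first exact: cvg_quad.
by apply: cvgMl_tmp; exact: cvg_dotv.
Qed.

Lemma continuous_discount (t : R) :
  continuous (fun s => expR (- alpha G * (s - t))).
Proof.
move=> s; apply: continuous_comp; last exact: continuous_expR.
by apply: cvgMl_tmp; apply: cvgB; [exact: cvg_id|exact: cvg_cst].
Qed.

Lemma continuous_discounted_cost (t : R) (X : R -> 'cV[R]_(n + n))
    (u : R -> 'cV[R]_m) (w : R -> 'cV[R]_d) :
  {within `[t, +oo[, continuous X} -> {within `[t, +oo[, continuous u} ->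
  {within `[t, +oo[, continuous w} ->
  {within `[t, +oo[, continuous (discounted_cost G t X u w)}.
Proof.
move=> cX cu cw s; apply: cvgM.
  by apply: continuous_subspaceT => {}s; exact: continuous_discount.
apply: cvgB.
  by apply: cvgD; apply: cvg_quad; [exact (@cX s)|exact (@cu s)].
by apply: cvgMl_tmp; apply: cvg_dotv; exact (@cw s).
Qed.

(** The dissipation inequalities for the discounted value [F]: its derivative plus the discounted
    cost is a positive factor times the Hamiltonian. *)
Lemma play_performance (t : R) (X : R -> 'cV[R]_(n + n))
    (u : R -> 'cV[R]_m) (w : R -> 'cV[R]_d) : play G V t X u w ->
  ((forall s, t < s -> 0 <= hamiltonian G V s (X s) (u s) (w s)) ->
    V t (X t) <= performance G t X u w) /\
  ((forall s, t < s -> hamiltonian G V s (X s) (u s) (w s) <= 0) ->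
    performance G t X u w <= V t (X t)).
Proof.
case=> -[cu cw _] [cX dX ic F0].
pose E s := expR (- alpha G * (s - t)).
pose F s := E s * V s (X s).
have cF : {within `[t, +oo[, continuous F}.
  move=> s; apply: cvgM.
    by apply: continuous_subspaceT => {}s; exact: continuous_discount.
  apply: cvg_value; [exact: nbhs_subspace_filter| |exact (@cX s)].
    (* Continuity of the identity says that the subspace filter at [s] refines [nbhs s]. *)
    exact: (@continuous_subspaceT _ _ _ id (fun _ => cvg_id) s).
have cc := continuous_discounted_cost cX cu cw.
have dF s : t < s -> is_derive s 1 F
    (E s * hamiltonian G V s (X s) (u s) (w s) - discounted_cost G t X u w s).
  move=> ts; have DV := is_derive_value_along (dX _ ts).
  have DE : is_derive s 1 E (- alpha G * E s).
    have Dlin : is_derive s 1 (fun r => - alpha G * (r - t)) (- alpha G).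
      apply: (@is_derive_quadratic _ _ _ _ _ _ 0) => h.
      by rewrite /GRing.scale/=; ring.
    rewrite mulrC; exact: (@is_derive1_comp _ expR _ _ _ _ _ Dlin).
  have -> : F = E * (fun s => V s (X s)) by [].
  apply: is_derive_eq; rewrite /discounted_cost -/(E s) /GRing.scale/=.
  by ring.
(* The discount factor is 1 at the initial time. *)
have FE : V t (X t) = F t by rewrite /F /E subrr mulr0 expR0 mul1r.
split=> H; rewrite FE.
- apply: dissipation_le => // s ts; eexists; first exact: dF.
  by rewrite subrK mulr_ge0 ?expR_ge0 ?H.
- apply: dissipation_ge => // s ts; eexists; first exact: dF.
  by rewrite subrK mulr_ge0_le0 ?expR_ge0 ?H.
Qed.

(** * Stationarity, the saddle point and the characterization of optimal pairs *)

(** Derivatives are unique, and a vector orthogonal to every direction is zero. *)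
Lemma stationary_u t X u w : (wR G)^T = wR G ->
  (forall v, is_derive u v (fun u => hamiltonian G V t X u w) 0) <->
  wR G *m u + B1^T *m costate t X = 0.
Proof.
move=> RT; split=> [H|H v].
  apply: dotv_eq0P => v.
  have [_] := is_derive_hamiltonian_u t X u w v RT; have [_ ->] := H v.
  by lra.
by have := is_derive_hamiltonian_u t X u w v RT; rewrite H dot0v mulr0.
Qed.

Lemma stationary_w t X u w : (wR G)^T = wR G ->
  (forall v, is_derive w v (fun w => hamiltonian G V t X u w) 0) <->
  D1^T *m costate t X - gamma G ^+ 2 *: w = 0.
Proof.
move=> RT; split=> [H|H v].
  apply: dotv_eq0P => v.
  have [_] := is_derive_hamiltonian_w t X u w v RT; have [_ ->] := H v.
  by lra.
by have := is_derive_hamiltonian_w t X u w v RT; rewrite H dot0v mulr0.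
Qed.

Section Policies.
Context (us : R -> 'cV[R]_(n + n) -> 'cV[R]_m)
  (ws : R -> 'cV[R]_(n + n) -> 'cV[R]_d).

Lemma optimal_pair_saddle_point : sym_posdef (wR G) ->
  optimal_pair G V us ws -> saddle_point G V us ws.
Proof.
move=> Rpos opt; have RT := Rpos.1.
(* Expanding around the optimal pair removes the constant and both linear terms. Following [ws]
   kills the attack square and following [us] the control square, which fixes the sign of the
   Hamiltonian. *)
have HE t X u w : hamiltonian G V t X u w = quad (wR G) (u - us t X)
    - gamma G ^+ 2 * dotv (w - ws t X) (w - ws t X).
  have [/stationary_u-/(_ RT) Hu /stationary_w-/(_ RT) Hw H0] := opt t X.
  have := hamiltonian_shift t X (us t X) (ws t X) (u - us t X) (w - ws t X) RT.
  by rewrite !subrK H0 Hu Hw !dot0v => ->; ring.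
move=> t X u w pl; have [Hge Hle] := play_performance pl.
have ge : follows t X w ws -> V t (X t) <= performance G t X u w.
  move=> fw; apply: Hge => s ts; rewrite HE fw ?(ltW ts)// subrr dot0v.
  by rewrite mulr0 subr0 sym_posdef_quad_ge0.
have le : follows t X u us -> performance G t X u w <= V t (X t).
  move=> fu; apply: Hle => s ts; rewrite HE fu ?(ltW ts)// subrr quadE dot0v.
  by rewrite sub0r oppr_le0 mulr_ge0 ?sqr_ge0 ?dotv_ge0.
by split=> // fu fw; apply/le_anti; rewrite le// ge.
Qed.

Lemma optimal_pairP : sym_posdef (wQ1 G) -> sym_posdef (wR G) ->
    gamma G != 0 ->
  optimal_pair G V us ws <->
  [/\ (forall t X, us t X = - (Ri *m B1^T *m costate t X)) /\
       (forall t X, ws t X = g2 *: (D1^T *m costate t X)),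
     riccati = 0,
     forall t : R, is_derive t 1 Pi (dPi t) &
     forall t : R, is_derive t 1 Gam (dGam t)].
Proof.
move=> Qpos Rpos g0; have RT := Rpos.1.
have Runit := sym_posdef_unitmx Rpos.
have g20 : gamma G ^+ 2 != 0 by rewrite sqrf_eq0.
split=> [opt|[[usE wsE] ric DPi DGam] t X].
  (* The stationarity equations are linear in the inputs and are solved by inverting [wR G] and
     [gamma G ^+ 2]. *)
  have usE t X : us t X = - (Ri *m B1^T *m costate t X).
    have [/stationary_u-/(_ RT)/eqP + _ _] := opt t X.
    rewrite addr_eq0 => /eqP/(congr1 (mulmx Ri)).
    by rewrite mulKmx// mulmxN mulmxA.
  have wsE t X : ws t X = g2 *: (D1^T *m costate t X).
    have [_ /stationary_w-/(_ RT)/eqP + _] := opt t X.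
    by rewrite subr_eq0 => /eqP ->; rewrite scalerA mulVf// scale1r.
  have van t :
      [/\ riccati = 0, 'D_1 Pi t - dPi t = 0 & 'D_1 Gam t - dGam t = 0].
    apply: affine_quad_eq0; first exact: trmx_riccati Qpos.1 RT.
    move=> X; rewrite -hamiltonian_optimal// -usE -wsE.
    by have [] := opt t X.
  (* The Riccati equation does not involve time, so any instant, here 0, will do. *)
  split=> //; first by have [] := van 0.
  - move=> t; have [_ /eqP + _] := van t; rewrite subr_eq0 => /eqP <-.
    exact/derivableP/hPi.
  - move=> t; have [_ _ /eqP] := van t; rewrite subr_eq0 => /eqP <-.
    exact/derivableP/hGam.
split.
- apply/stationary_u => //; rewrite usE mulmxN -mulmxA mulKVmx//.
  by rewrite addNr.
- by apply/stationary_w => //; rewrite wsE scalerA mulfV// scale1r subrr.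
- rewrite usE wsE hamiltonian_optimal// ric.
  have [_ ->] := DPi t; have [_ ->] := DGam t.
  by rewrite !subrr quadE mul0mx !dotv0; ring.
Qed.

End Policies.
End AffineQuadValue.

Theorem theorem4 (R : realType) (n m d : nat) (G : agent R n m d)
  (P : 'M[R]_(n + n)) (Pi : R -> 'cV[R]_(n + n)) (Gam : R -> R)
  (us : R -> 'cV[R]_(n + n) -> 'cV[R]_m)
  (ws : R -> 'cV[R]_(n + n) -> 'cV[R]_d)
  (hstab : stabilizable (sysA G) (sysB G))
  (hQ1 : sym_posdef (wQ1 G)) (hR : sym_posdef (wR G))
  (halpha : 0 < alpha G) (hgamma : 0 < gamma G)
  (hP : P^T = P)
  (hPi : forall t : R, derivable Pi t 1)
  (hGam : forall t : R, derivable Gam t 1) :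
  let T := augT G in
  let B1 := augB1 G in
  let D1 := augD1 G in
  let E1 := augE1 G in
  let Q := augQ G in
  let Ri := invmx (wR G) in
  let g2 := (gamma G ^+ 2)^-1 in
  let V := affine_quad_value P Pi Gam in
  (optimal_pair G V us ws <->
   [/\ (forall (t : R) (X : 'cV[R]_(n + n)),
          us t X = - (Ri *m B1^T *m (P *m X + Pi t))) /\
       (forall (t : R) (X : 'cV[R]_(n + n)),
          ws t X = g2 *: (D1^T *m (P *m X + Pi t))),
       P *m T + T^T *m P - alpha G *: P - P *m B1 *m Ri *m B1^T *m P
         + g2 *: (P *m D1 *m D1^T *m P) + Q = 0,
       forall t : R, is_derive t 1 Pi
         (((alpha G)%:M + P *m B1 *m Ri *m B1^T - T^T
             - g2 *: (P *m D1 *m D1^T)) *m Pi t - P *m E1 *m ups G t) &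
       forall t : R, is_derive t 1 Gam
         (alpha G * Gam t
          + ((Pi t)^T *m B1 *m Ri *m B1^T *m Pi t) 0 0
          - g2 * ((Pi t)^T *m D1 *m D1^T *m Pi t) 0 0
          - 2 * ((ups G t)^T *m E1^T *m Pi t) 0 0)]) /\
  (optimal_pair G V us ws -> saddle_point G V us ws).
Proof.
move=> T B1 D1 E1 Q Ri g2 V; split.
  by apply: optimal_pairP => //; rewrite gt_eqF.
exact: optimal_pair_saddle_point.
Qed.
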